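(* Let $\mathbf{S}$ be a finite monoid. Suppose there exist positive integers $p,q$ such that $\mathbf{S}$ satisfies the following: (i) for any $m,n\in\mathbb{N}$, $\mathbf{S}\models \mathcal{C}_{n,p,q}\overline{\mathcal{C}_{m,p,q}}\approx\overline{\mathcal{C}_{m,p,q}}\mathcal{C}_{n,p,q}$; (ii) $\mathbf{S}\models\mathscr{A}_{\alpha,\beta}$ for some $\alpha,\beta\in\mathbb{N}$ with $\alpha\le 2p+2q$; (iii) $\mathcal{C}_{2,p,q}=x_1^px_2^px_1^qx_2^q$ is an isoterm for $\mathbf{S}$. Then $\mathbf{S}$ is non-finitely related.
   Context: $\mathbb{N}=\{1,2,3,\dots\}$. An operation $f:A^n\to A$ preserves a relation $R\subseteq A^k$ if $f(r_1,\dots,r_n)\in R$ for all $r_1,\dots,r_n\in R$, with $f$ applied coordinatewise. An algebra $\mathbf{A}$ with universe $A$ is finitely related if there is a finite set of finitary relations on $A$ such that the finitary operations on $A$ preserving all of those relations are precisely the term functions of $\mathbf{A}$; otherwise it is non-finitely related. Monoids are regarded as algebras with a single binary operation; the $n$-ary term functions are those induced by words in $n$ variables. For $n,p,q\in\mathbb{N}$ the chain word in $n$ variables is $$\mathcal{C}_{n,p,q}=x_1^px_2^px_1^qx_3^px_2^qx_4^px_3^q\cdots x_n^px_{n-1}^qx_n^q$$ (so $\mathcal{C}_{1,p,q}=x_1^{p+q}$ and $\mathcal{C}_{2,p,q}=x_1^px_2^px_1^qx_2^q$), and $\overline{\mathcal{C}_{n,p,q}}$ is the same word written in variables $y_1,\dots,y_n$,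 disjoint from the $x_i$. $\mathscr{A}_{\alpha,\beta}$ is the set of identities $\{x^\alpha\approx x^{\alpha+\beta},\ t_1xt_2x\cdots t_\alpha x\approx x^\alpha t_1t_2\cdots t_\alpha\}$. A word $\mathbf{w}$ is an isoterm for $\mathbf{S}$ if, for every word $\mathbf{u}$, $\mathbf{S}\models\mathbf{u}\approx\mathbf{w}$ implies $\mathbf{u}=\mathbf{w}$. *)

(* Defs.v *)
From HB Require Import structures.
From mathcomp Require Import all_boot.

Set Implicit Arguments.
Unset Strict Implicit.
Unset Printing Implicit Defensive.

#[short(type="finMonoidType")]
HB.structure Definition FinMonoid := {S of monoid.Monoid S & Finite S}.

(** ** Finitely related algebras *)

Section FinitelyRelated.
Variable A : finType.

(* Arities range over the positive integers, for operations and relations. *)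
Definition operation (n : nat) := {ffun 'I_n.+1 -> A} -> A.

Definition relation := {k : nat & {set {ffun 'I_k.+1 -> A}}}.

Definition preserves (n : nat) (f : operation n) (R : relation) : Prop :=
  forall r : 'I_n.+1 -> {ffun 'I_(tag R).+1 -> A},
    (forall i, r i \in tagged R) ->
    [ffun j => f [ffun i => r i j]] \in tagged R.

(* An algebra with universe A enters only through its term functions:
   T f says that f is one of them. *)
Definition finitely_related (T : forall n : nat, operation n -> Prop) : Prop :=
  exists Rs : seq relation,
    forall (n : nat) (f : operation n),
      (forall R : relation, R \in Rs -> preserves f R) <-> T n f.

End FinitelyRelated.

(** ** Words and identities *)

Section Words.
Variable S : finMonoidType.

(* Words are nonempty, the signature consisting of one binary operation; the
   predicates below impose this wherever an arbitrary word is quantified. *)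
Definition eval_word (X : Type) (phi : X -> S) (w : seq X) : S :=
  (\big[*%g/1]_(x <- w) phi x)%g.

Definition satisfies (X : Type) (u v : seq X) : Prop :=
  forall phi : X -> S, eval_word phi u = eval_word phi v.

Definition is_term_function (n : nat) (f : operation S n) : Prop :=
  exists2 w : seq 'I_n.+1, w != [::] &
    forall a : {ffun 'I_n.+1 -> S}, f a = eval_word a w.

Definition isoterm (w : seq nat) : Prop :=
  forall u : seq nat, u != [::] -> satisfies u w -> u = w.

(* x is the letter 0 and t_i is the letter i. *)
Definition satisfies_A (alpha beta : nat) : Prop :=
  satisfies (nseq alpha 0) (nseq (alpha + beta) 0) /\
  satisfies (flatten [seq [:: i; 0] | i <- iota 1 alpha])
            (nseq alpha 0 ++ iota 1 alpha).

End Words.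

Definition nonfinitely_related_monoid (S : finMonoidType) : Prop :=
  ~ finitely_related (@is_term_function S).

(** ** Chain words *)

(* x_i is the letter i >= 1. Grouped as
   x_1^p (x_2^p x_1^q) (x_3^p x_2^q) ... (x_n^p x_{n-1}^q) x_n^q. *)
Definition chain_word (n p q : nat) : seq nat :=
  nseq p 1 ++ flatten [seq nseq p i.+1 ++ nseq q i | i <- iota 1 n.-1]
    ++ nseq q n.

(* The letters x_i become inl i, the letters y_i become inr i. *)
Definition chain_x (n p q : nat) : seq (nat + nat) := map inl (chain_word n p q).
Definition chain_y (n p q : nat) : seq (nat + nat) := map inr (chain_word n p q).

(* Main.v *)
Require Import Defs.
From HB Require Import structures.
From mathcomp Require Import all_boot.

(** Close the chain word up into a circle: on a finite cyclically ordered set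
    of letters, neighbours x, y (with y following x) should interact as in
    x^p y^p x^q y^q.  No word does this for every neighbouring pair at once,
    since its first letter would have to be preceded by its own predecessor.
    But once the circle is cut at a letter x, there is such a word: the letter
    x itself p+q times, followed by the chain word on the remaining letters in
    the cyclic order starting after x ([cyclic_word]).

    The key point is that, on assignments giving equal values to two or more
    letters, it does not matter at which of the letters with a repeated value
    the circle is cut ([cyclic_word_repeated]).  Indeed a repeated value is
    taken at least 2(p+q) >= alpha times, so the identities A_{alpha,beta} move
    all its occurrences to the front ([gather]); that is, the corresponding
    letters are erased.  Erasing a letter of a chain splits it into the product
    of two chains ([chain_erased]), so cutting at x and erasing y, or cutting
    at y and erasing x, leaves the same two arcs of the circle, in opposite
    orders, and chains commute in S ([cyclic_word_erased]).

    Hence these words, each used on the assignments repeating the value of the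
    letter where it is cut, glue to an operation f ([cyclic_operation]).
    - f preserves every relation with fewer elements than f has arguments:
      among the arguments two rows coincide, and on such rows f agrees with a
      term function ([locally_term_preserves]).
    - f is not a term function ([cyclic_operation_not_term]): if a word
      represents f, let h be its first letter and i the predecessor of h on
      the circle.  Sending all other letters to 1 shows that the restriction of
      the word to i and h, which begins with h, takes the same values in S as
      the chain i^p h^p i^q h^q, against the isoterm hypothesis.
    As f exists in all arities from 4 on, no finite set of relations determines
    the term functions of S. *)

(** * Evaluation of words *)

Lemma eval_word_cat {S : finMonoidType} {X : Type} (phi : X -> S) (u v : seq X) :
  eval_word phi (u ++ v) = (eval_word phi u * eval_word phi v)%g.
Proof. by rewrite /eval_word big_cat. Qed.

Lemma eval_word_nseq {S : finMonoidType} {X : Type} (phi : X -> S) (n : nat)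
    (x : X) :
  eval_word phi (nseq n x) = (phi x ^+ n)%g.
Proof.
elim: n => [|n IHn]; first exact: big_nil.
by rewrite /eval_word big_cons -/(eval_word _ _) IHn expgS.
Qed.

Lemma eval_word_map {S : finMonoidType} {X Y : Type} (phi : Y -> S) (f : X -> Y)
    (w : seq X) :
  eval_word phi (map f w) = eval_word (phi \o f) w.
Proof. exact: big_map. Qed.

Lemma eq_eval_word {S : finMonoidType} {X : Type} (phi psi : X -> S)
    (w : seq X) :
  phi =1 psi -> eval_word phi w = eval_word psi w.
Proof. by move=> eq_phi; apply: eq_bigr => x _. Qed.

(** * Moving frequent values to the front *)

Definition erase {S : finMonoidType} {X : Type} (P : pred X) (phi : X -> S) :
  X -> S := fun x => if P x then 1%g else phi x.

(** Substituting arbitrary elements, in particular 1, for the letters t_i of the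
    second identity. *)
Lemma gather_prod {S : finMonoidType} {alpha beta : nat} (z : S) (ts : seq S) :
  satisfies_A S alpha beta -> size ts = alpha ->
  (\prod_(t <- ts) (t * z) = z ^+ alpha * \prod_(t <- ts) t)%g.
Proof.
case=> _ hA size_ts; pose phi i := if i is j.+1 then nth 1%g ts j else z.
have phi_iota : [seq phi i | i <- iota 1 alpha] = ts.
  by rewrite (iotaDl 1 0) -map_comp -size_ts; apply: mkseq_nth.
have := hA phi; rewrite eval_word_cat eval_word_nseq /eval_word.
rewrite big_flatten big_map /= -[in X in _ = _ -> X]phi_iota !big_map => <-.
by apply: eq_bigr => i _; rewrite !big_cons big_nil mulg1.
Qed.

(** Beyond the first alpha occurrences, further ones are absorbed one at a time:
    one of the alpha copies of z already in front is set aside, and the identity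
    is applied to the other alpha - 1 copies together with the new one. *)
Lemma absorb_last {S : finMonoidType} {alpha beta : nat} (z t : S) :
  0 < alpha -> satisfies_A S alpha beta ->
  (z ^+ alpha * t * z = z ^+ alpha * z * t)%g.
Proof.
case: alpha => // a _ hA.
have := gather_prod z (nseq a 1%g ++ [:: t]) hA.
rewrite size_cat size_nseq addn1 => /(_ erefl).
rewrite !big_cat /= !big_cons !big_nil !mulg1.
have -> : (\prod_(x <- nseq a 1) (x * z) = z ^+ a)%g.
  by rewrite -[in RHS](mul1g z); exact: (eval_word_nseq (fun x => x * z)%g).
have -> : (\prod_(x <- nseq a 1%g) x = 1 ^+ a :> S)%g by exact: (eval_word_nseq id).
rewrite expg1n mul1g => E.
by rewrite -expgSr [in LHS]expgS -!mulgA E mulgA -expgS.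
Qed.

(** The bookkeeping that puts a word with enough occurrences of z in the shape
    t_1 z t_2 z ... t_k z w', to which the identity applies; the t_j are
    recorded by their values, which do not change under erasure. *)
Lemma split_first_occurrences {S : finMonoidType} {X : Type} (P : pred X)
    (phi : X -> S) (z : S) (k : nat) (w : seq X) :
  (forall x, P x -> phi x = z) -> k <= count P w ->
  exists ts : seq S, exists w' : seq X,
    [/\ size ts = k, count P w = k + count P w',
        eval_word phi w = (\prod_(t <- ts) (t * z) * eval_word phi w')%g
      & eval_word (erase P phi) w
        = (\prod_(t <- ts) t * eval_word (erase P phi) w')%g].
Proof.
move=> phiP; elim: w k => [|x w IHw] [|k] //= le_k.
- by exists [::], [::]; rewrite !big_nil !mul1g.
- by exists [::], (x :: w); rewrite !big_nil !mul1g.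
rewrite /eval_word !big_cons -!/(eval_word _ _) {1 2}/erase.
case Px: (P x) le_k => le_k.
  have [ts [w' [sz cnt ev er]]] := IHw k le_k.
  exists (1%g :: ts), w'; rewrite !big_cons /= sz cnt ev er (phiP _ Px).
  by rewrite !mul1g !mulgA.
have [[|t ts] [w' [sz cnt ev er]]] := IHw k.+1 le_k => //.
exists ((phi x * t)%g :: ts), w'; rewrite !big_cons in ev er *.
by split; rewrite ?ev ?er ?mulgA.
Qed.

Lemma absorb_all {S : finMonoidType} {X : Type} {alpha beta : nat} (P : pred X)
    (phi : X -> S) (z t : S) (w : seq X) :
  0 < alpha -> satisfies_A S alpha beta -> (forall x, P x -> phi x = z) ->
  (z ^+ alpha * t * eval_word phi w
   = z ^+ (alpha + count P w) * t * eval_word (erase P phi) w)%g.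
Proof.
move=> alpha_gt0 hA phiP; elim: w t => [|x w IHw] t /=.
  by rewrite addn0 /eval_word !big_nil.
rewrite /eval_word !big_cons -!/(eval_word _ _) {1}/erase.
case Px: (P x); last by rewrite add0n !mulgA -(mulgA _ t) IHw !mulgA.
rewrite (phiP _ Px) mul1g mulgA (absorb_last _ _ alpha_gt0 hA).
rewrite -expgSr expgS -2!mulgA (mulgA (z ^+ alpha)%g) IHw /=.
by rewrite addnCA add1n expgS !mulgA.
Qed.

(** The form in which the identities are used: a value that is taken
    alpha times can be pulled out of the whole word.  Only the number of its
    occurrences remains visible, not their positions. *)
Lemma gather {S : finMonoidType} {X : Type} {alpha beta : nat} (P : pred X)
    (phi : X -> S) (z : S) (w : seq X) :
  0 < alpha -> satisfies_A S alpha beta -> (forall x, P x -> phi x = z) ->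
  alpha <= count P w ->
  eval_word phi w = (z ^+ count P w * eval_word (erase P phi) w)%g.
Proof.
move=> alpha_gt0 hA phiP le_alpha.
have [ts [w' [sz -> -> ->]]] := split_first_occurrences _ _ _ _ _ phiP le_alpha.
rewrite (gather_prod z ts hA sz) (absorb_all _ _ _ _ _ alpha_gt0 hA phiP).
by rewrite !mulgA.
Qed.

(** * Chains over arbitrary lists of letters *)

(** The part of a chain following the first block x^p of its letter x, so that
    x^q is still due after the first block of the next letter. *)
Fixpoint chain_from {X : Type} (p q : nat) (x : X) (s : seq X) : seq X :=
  if s is y :: s' then nseq p y ++ nseq q x ++ chain_from p q y s'
  else nseq q x.

Definition chain {X : Type} (p q : nat) (s : seq X) : seq X :=
  if s is x :: s' then nseq p x ++ chain_from p q x s' else [::].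

Lemma map_chain {X Y : Type} (f : X -> Y) (p q : nat) (s : seq X) :
  map f (chain p q s) = chain p q (map f s).
Proof.
case: s => //= x s; rewrite map_cat map_nseq; congr (_ ++ _).
by elim: s x => [|y s IHs] x /=; rewrite ?map_cat !map_nseq ?IHs.
Qed.

Lemma count_chain {X : Type} (P : pred X) (p q : nat) (s : seq X) :
  count P (chain p q s) = (p + q) * count P s.
Proof.
case: s => [|x s] /=; first by rewrite muln0.
rewrite count_cat count_nseq.
suff -> : count P (chain_from p q x s) = q * P x + (p + q) * count P s.
  by rewrite mulnDr (mulnDl p q (P x)) addnA (mulnC _ p).
elim: s x => [|y s IHs] x /=; first by rewrite count_nseq muln0 addn0 mulnC.
rewrite !count_cat !count_nseq IHs mulnDr (mulnDl p q (P y)) addnCA -!addnA.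
by rewrite (mulnC _ p) (mulnC _ q).
Qed.

Lemma mem_chain {X : eqType} {p q : nat} {s : seq X} {x : X} :
  x \in chain p q s -> x \in s.
Proof.
rewrite -has_pred1 has_count count_chain muln_gt0 => /andP[_].
by rewrite -has_count has_pred1.
Qed.

Lemma chain_wordE (n p q : nat) :
  0 < n -> chain_word n p q = chain p q (iota 1 n).
Proof.
case: n => //= n _; rewrite /chain_word /=; congr (_ ++ _); rewrite -[n.+1]add1n.
elim: n 1 => [|n IHn] m /=; first by rewrite addn0.
by rewrite -addSnnS -!catA IHn.
Qed.

(** In ... y^p w^q x^p y^q z^p x^q ... the blocks of x are the only link between
    y and z; without them y^q closes one chain and z^p opens the next. *)
Lemma chain_erased {S : finMonoidType} {X : Type} (p q : nat) (phi : X -> S)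
    (u : seq X) (x : X) (v : seq X) :
  phi x = 1%g ->
  eval_word phi (chain p q (u ++ x :: v))
  = (eval_word phi (chain p q u) * eval_word phi (chain p q v))%g.
Proof.
move=> phix.
have nseqx n : eval_word phi (nseq n x) = 1%g.
  by rewrite eval_word_nseq phix expg1n.
have from_x : eval_word phi (chain_from p q x v) = eval_word phi (chain p q v).
  case: v => [|y v] /=; first by rewrite nseqx /eval_word big_nil.
  by rewrite !eval_word_cat nseqx mul1g.
case: u => [|y u] /=.
  by rewrite eval_word_cat nseqx from_x /eval_word big_nil.
rewrite !eval_word_cat -mulgA; congr (_ * _)%g.
elim: u y => [|y' u IHu] y /=; rewrite !eval_word_cat.
  by rewrite nseqx mul1g from_x.
by rewrite IHu !mulgA.
Qed.

(** * Commuting chains *)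

Definition chains_commute (S : finMonoidType) (p q : nat) : Prop :=
  forall m n : nat, 0 < m -> 0 < n ->
    satisfies S (chain_x n p q ++ chain_y m p q)
                (chain_y m p q ++ chain_x n p q).

(** The identities of [chains_commute] have disjoint letters on the two sides,
    so they apply to any two chains, even with letters in common. *)
Lemma chains_commuteP {S : finMonoidType} {X : Type} {p q : nat}
    (phi : X -> S) (s t : seq X) :
  chains_commute S p q ->
  commute (eval_word phi (chain p q s)) (eval_word phi (chain p q t)).
Proof.
move=> hC; rewrite /commute.
case: (posnP (size s)) => [/size0nil->|s_gt0].
  by rewrite /= {1 4}/eval_word big_nil mul1g mulg1.
case: (posnP (size t)) => [/size0nil->|t_gt0].
  by rewrite /= {2 3}/eval_word big_nil mul1g mulg1.
pose val_of (r : seq X) i := nth 1%g (map phi r) i.-1.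
pose psi (c : nat + nat) : S :=
  match c with inl i => val_of s i | inr i => val_of t i end.
have evalE (r : seq X) : 0 < size r ->
    eval_word (val_of r) (chain_word (size r) p q)
    = eval_word phi (chain p q r).
  move=> r_gt0; rewrite (chain_wordE _ _ _ r_gt0).
  rewrite -(eval_word_map id) map_chain -[RHS](eval_word_map id) map_chain.
  congr (eval_word _ (chain _ _ _)).
  rewrite (iotaDl 1 0) -map_comp -[in iota _ _](size_map phi).
  exact: mkseq_nth.
have := hC _ _ t_gt0 s_gt0 psi; rewrite !eval_word_cat !eval_word_map.
by rewrite !(eq_eval_word (psi \o inl) (val_of s) _ (fun=> erefl))
           !(eq_eval_word (psi \o inr) (val_of t) _ (fun=> erefl)) !evalE.
Qed.

(** * The circle cut at a letter *)

(** The letters following x when s is read as a cycle. *)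
Definition after {X : eqType} (s : seq X) (x : X) : seq X :=
  drop (index x s).+1 s ++ take (index x s) s.

Lemma after_cat {X : eqType} (u v : seq X) (x : X) :
  uniq (u ++ x :: v) -> after (u ++ x :: v) x = v ++ u.
Proof.
rewrite cat_uniq /= negb_or => /and3P[_ /andP[xNu _] _].
rewrite /after index_cat (negPf xNu) /= eqxx addn0.
by rewrite take_size_cat // -cat_rcons drop_size_cat // size_rcons.
Qed.

Lemma perm_after {X : eqType} (s : seq X) (x : X) :
  x \in s -> perm_eq (x :: after s x) s.
Proof. by move=> xs; rewrite -rot_index // perm_rot. Qed.

Lemma after_rot {X : eqType} (n : nat) (s : seq X) (x : X) :
  uniq s -> x \in s -> after (rot n s) x = after s x.
Proof.
rewrite -[in uniq s](rot_uniq n) -{2 4}(cat_take_drop n s) /rot mem_cat.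
move: (take n s) (drop n s) => s1 s2 s_uniq.
have s_uniq' : uniq (s1 ++ s2) by rewrite uniq_catC.
case/orP=> /splitPr def_s; case: def_s s_uniq s_uniq' => u v.
  by rewrite catA -(catA u) /= => *; rewrite !after_cat ?catA.
by rewrite (catA s1) -(catA u) /= => *; rewrite !after_cat ?catA.
Qed.

(** The letters x and y cut the circle into two arcs u and v, which are met in
    opposite orders when starting from x and from y. *)
Lemma after_swap {X : eqType} (s u v : seq X) (x y : X) :
  uniq s -> x \in s -> after s x = u ++ y :: v -> after s y = v ++ x :: u.
Proof.
move=> s_uniq xs def_x.
have rot_s : rot (index x s) s = (x :: u) ++ y :: v.
  by rewrite rot_index //; congr (_ :: _).
have ys : y \in s.
  by rewrite -(mem_rot (index x s)) rot_s mem_cat !inE eqxx !orbT.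
rewrite -(after_rot (index x s) _ _ s_uniq ys) rot_s after_cat //.
by rewrite -rot_s rot_uniq.
Qed.

(** The p+q copies of x make every letter occur equally often, so that the
    letters at which two cuts are made play symmetric roles. *)
Definition cyclic_word {X : eqType} (p q : nat) (s : seq X) (x : X) : seq X :=
  nseq (p + q) x ++ chain p q (after s x).

Lemma count_cyclic_word {X : eqType} (P : pred X) (p q : nat) (s : seq X)
    (x : X) :
  x \in s -> count P (cyclic_word p q s x) = (p + q) * count P s.
Proof.
move=> xs; rewrite count_cat count_nseq count_chain mulnC -mulnDr.
by have /permP/(_ P) <- := perm_after s x xs.
Qed.

(** Cutting at x and erasing y leaves the product of the two arcs between x and
    y, and so does cutting at y and erasing x, in the other order. *)
Lemma cyclic_word_erased {S : finMonoidType} {X : eqType} {p q : nat}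
    (phi : X -> S) (s : seq X) (x y : X) :
  chains_commute S p q -> uniq s -> x \in s -> y \in s ->
  phi x = 1%g -> phi y = 1%g ->
  eval_word phi (cyclic_word p q s x) = eval_word phi (cyclic_word p q s y).
Proof.
move=> hC s_uniq xs ys phix phiy; have [-> // | xDy] := eqVneq x y.
have : y \in x :: after s x by rewrite (perm_mem (perm_after _ _ xs)).
rewrite inE eq_sym (negPf xDy) => /splitPr Ex.
case E: _ / Ex => [u v]; have Ey := after_swap _ _ _ _ _ s_uniq xs E.
rewrite !eval_word_cat !eval_word_nseq phix phiy E Ey !chain_erased //.
by congr (_ * _)%g; apply: chains_commuteP.
Qed.

(** * Gluing the cuts into an operation *)

Definition repeated {I : finType} {A : eqType} (a : I -> A) (i : I) : bool :=
  [exists j, (j != i) && (a j == a i)].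

(** The values at i and at k are pulled out of both words: each is repeated,
    so it is taken at least 2(p+q) times, and equally often in the two words.
    What remains has i and k erased. *)
Lemma cyclic_word_repeated {S : finMonoidType} {I : finType}
    {p q alpha beta : nat} (a : I -> S) (i k : I) :
  chains_commute S p q -> 0 < alpha -> alpha <= 2 * p + 2 * q ->
  satisfies_A S alpha beta -> repeated a i -> repeated a k ->
  eval_word a (cyclic_word p q (enum I) i)
  = eval_word a (cyclic_word p q (enum I) k).
Proof.
move=> hC alpha_gt0 le_alpha hA rep_i rep_k.
have count_fiber j : repeated a j ->
    alpha <= (p + q) * count [pred l | a l == a j] (enum I).
  case/existsP=> l /andP[lDj al]; apply: leq_trans le_alpha _.
  rewrite -mulnDr mulnC leq_mul2l; apply/orP; right.
  rewrite -size_filter -(card_uniqP (filter_uniq _ (enum_uniq I))).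
  apply/card_gt1P; exists l, j; split=> //; rewrite mem_filter mem_enum /=.
    by rewrite al.
  by rewrite eqxx.
have collect (b : I -> S) (P : pred I) z l :
    (forall x, P x -> b x = z) -> alpha <= (p + q) * count P (enum I) ->
    eval_word b (cyclic_word p q (enum I) l)
    = (z ^+ ((p + q) * count P (enum I))
       * eval_word (erase P b) (cyclic_word p q (enum I) l))%g.
  move=> bP; rewrite -(count_cyclic_word P p q _ l) ?mem_enum // => le_cnt.
  exact: gather alpha_gt0 hA bP le_cnt.
(* One round of gathering erases both letters when their values agree;
   otherwise the two fibres are disjoint and the value at k needs its own. *)
set Pi := [pred l | a l == a i]; set Pk := [pred l | a l == a k].
have aPi x : Pi x -> a x = a i by move/eqP.
rewrite !(collect a Pi (a i)) ?count_fiber //; congr (_ * _)%g.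
have [aik | aiNk] := eqVneq (a i) (a k).
  apply: cyclic_word_erased; rewrite ?enum_uniq ?mem_enum //.
    by rewrite /erase /= eqxx.
  by rewrite /erase /= aik eqxx.
have bPk x : Pk x -> erase Pi a x = a k.
  by move=> /eqP ax; rewrite /erase /= ax eq_sym (negPf aiNk).
rewrite !(collect (erase Pi a) Pk (a k)) ?count_fiber //; congr (_ * _)%g.
apply: cyclic_word_erased; rewrite ?enum_uniq ?mem_enum //.
  by rewrite /erase /= eqxx; case: ifP.
by rewrite /erase /= eqxx.
Qed.

(** The choice made by [pick] does not influence the value, by
    [cyclic_word_repeated]; injective tuples are sent to 1. *)
Definition cyclic_operation (S : finMonoidType) (p q n : nat) : operation S n :=
  fun a => if [pick i | repeated a i] is Some i
           then eval_word a (cyclic_word p q (enum 'I_n.+1) i) else 1%g.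

Lemma cyclic_operationE {S : finMonoidType} {p q alpha beta n : nat}
    (a : {ffun 'I_n.+1 -> S}) (i : 'I_n.+1) :
  chains_commute S p q -> 0 < alpha -> alpha <= 2 * p + 2 * q ->
  satisfies_A S alpha beta -> repeated a i ->
  cyclic_operation S p q n a = eval_word a (cyclic_word p q (enum 'I_n.+1) i).
Proof.
move=> hC alpha_gt0 le_alpha hA rep_i; rewrite /cyclic_operation.
case: pickP => [k rep_k | /(_ i)]; last by rewrite rep_i.
exact: cyclic_word_repeated hC alpha_gt0 le_alpha hA rep_k rep_i.
Qed.

(** Among n.+1 members of a relation with at most n elements, two coincide, at
    positions i and j say.  Then each tuple to which f is applied coordinatewise
    repeats its entry at i, and there f is the operation g attached to i. *)
Lemma locally_term_preserves {A : finType} (T : forall n, operation A n -> Prop)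
    {n : nat} (f : operation A n) (R : relation A) :
  #|tagged R| <= n -> (forall g, T n g -> preserves g R) ->
  (forall i, exists2 g, T n g &
    forall a : {ffun 'I_n.+1 -> A}, repeated a i -> f a = g a) ->
  preserves f R.
Proof.
move=> small_R T_R f_T r rR.
have /injectivePn[i [j iDj rij]] : ~~ injectiveb r.
  apply/negP=> /injectiveP /card_codom card_r.
  suff : #|codom r| <= #|tagged R| by rewrite card_r card_ord ltnNge small_R.
  apply: subset_leq_card; apply/subsetP=> _ /codomP[k ->]; apply: rR.
have [g Tg fg] := f_T i.
suff -> : [ffun c => f [ffun k => r k c]] = [ffun c => g [ffun k => r k c]].
  exact: T_R.
apply/ffunP=> c; rewrite !ffunE fg //.
by apply/existsP; exists j; rewrite !ffunE rij eqxx eq_sym iDj.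
Qed.

(** * The operation is not a term function *)

(** With h the first letter of the word and k, i, h consecutive on the circle,
    all letters other than i and h are sent to 1.  Then k is repeated as soon as
    there is a fourth letter l, so f may be computed by cutting at k, and the
    chain starting after k begins with i and h: f takes the value of the chain
    on i and h. *)
Lemma cyclic_operation_not_term {S : finMonoidType} {p q alpha beta n : nat} :
  3 <= n -> 0 < p -> chains_commute S p q -> 0 < alpha ->
  alpha <= 2 * p + 2 * q -> satisfies_A S alpha beta ->
  isoterm S (chain_word 2 p q) ->
  ~ is_term_function (cyclic_operation S p q n).
Proof.
move=> n_ge3 p_gt0 hC alpha_gt0 le_alpha hA iso [[|h w] // _ f_w].
have en_uniq := enum_uniq 'I_n.+1.
have perm_h := perm_after (enum 'I_n.+1) h (mem_enum _ h).
(* Starting after h, the circle ends with k and i; l witnesses that k is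
   repeated. *)
have [l [z [k [i def_h]]]] : exists l z k i,
    after (enum 'I_n.+1) h = (l :: z) ++ k :: [:: i].
  have : 3 <= size (after (enum 'I_n.+1) h).
    have := perm_size perm_h; rewrite size_enum_ord => - [->].
    exact: n_ge3.
  case: (after _ h) => // l s.
  case: (lastP s) => // s1 i; case: (lastP s1) => // s2 k _.
  by exists l, s2, k, i; rewrite -!cats1 -catA.
have := after_swap _ _ _ _ _ en_uniq (mem_enum _ h) def_h => /= def_k.
have : uniq (h :: after (enum 'I_n.+1) h) by rewrite (perm_uniq perm_h).
rewrite def_h /= !inE !mem_cat !inE !negb_or cat_uniq /= !inE !negb_or.
case/and3P=> /and4P[hDl hNz hDk hDi] /and3P[lNz lDk lDi].
case/and3P=> _ /and3P[_ iNz _] /andP[kDi _].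
have /iso : [seq if x == i then 1 else 2 | x <- h :: w & (x == i) || (x == h)]
            != [::] by rewrite /= eqxx orbT.
suff E : satisfies S
    [seq if x == i then 1 else 2 | x <- h :: w & (x == i) || (x == h)]
    (chain_word 2 p q).
  (* The first letters are 2 on the left, 1 on the right. *)
  move/(_ E); rewrite /= eqxx orbT /= (negPf hDi).
  by case: (p) p_gt0.
move=> phi; pose a := [ffun x => if x == i then phi 1 else
                                 if x == h then phi 2 else 1%g].
have := f_w a.
have rep_k : repeated a k.
  apply/existsP; exists l; rewrite lDk !ffunE (negPf lDi) (negPf kDi).
  by rewrite ![_ == h]eq_sym (negPf hDl) (negPf hDk) eqxx.
rewrite (cyclic_operationE _ _ hC alpha_gt0 le_alpha hA rep_k).
have -> : eval_word a (h :: w) = eval_word phi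
    [seq if x == i then 1 else 2 | x <- h :: w & (x == i) || (x == h)].
  rewrite eval_word_map /eval_word big_filter [RHS]big_mkcond.
  apply: eq_bigr => x _; rewrite ffunE /=.
  by case: eqP => // _; case: eqP.
move=> <-; rewrite eval_word_cat eval_word_nseq def_k ffunE.
rewrite (negPf kDi) [k == h]eq_sym (negPf hDk) expg1n mul1g.
rewrite -[[:: i, h, l & z]]/([:: i; h] ++ l :: z) chain_erased; last first.
  by rewrite ffunE (negPf lDi) [l == h]eq_sym (negPf hDl).
rewrite [X in (_ * X)%g](_ : _ = 1%g); last first.
  rewrite /eval_word big1_seq // => x /andP[_ /mem_chain x_z].
  rewrite ffunE; have [xi | _] := eqVneq x i.
    by rewrite xi (negPf iNz) in x_z.
  have [xh | //] := eqVneq x h.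
  by rewrite xh (negPf hNz) in x_z.
rewrite mulg1 /chain_word /= !eval_word_cat !eval_word_nseq !ffunE !eqxx.
by rewrite (negPf hDi) {1}/eval_word big_nil mulg1 !mulgA.
Qed.

Theorem theorem4p4 (S : finMonoidType)
    (hS : exists p q : nat,
      [/\ 0 < p, 0 < q,
          forall m n : nat, 0 < m -> 0 < n ->
            satisfies S (chain_x n p q ++ chain_y m p q)
                        (chain_y m p q ++ chain_x n p q),
          exists alpha beta : nat,
            [/\ 0 < alpha, 0 < beta, alpha <= 2 * p + 2 * q
              & satisfies_A S alpha beta]
        & isoterm S (chain_word 2 p q)]) :
  nonfinitely_related_monoid S.
Proof.
case: hS => p [q [p_gt0 _ hC [alpha [beta [alpha_gt0 _ le_alpha hA]]] iso]].
case=> Rs term_iff.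
(* The arity is n.+1: at least four, and exceeding the size of each relation. *)
pose n := maxn 3 (\max_(R <- Rs) #|tagged (R : relation S)|).
have n_ge3 : 3 <= n by rewrite /n !leq_max.
apply: (cyclic_operation_not_term n_ge3 p_gt0 hC alpha_gt0 le_alpha hA iso).
apply/term_iff => R R_Rs.
apply: (locally_term_preserves (@is_term_function S)).
- rewrite leq_max.
  by rewrite (leq_bigmax_seq (F := fun R : relation S => #|tagged R|)) ?orbT.
- by move=> g /term_iff; apply.
move=> i; exists (fun a => eval_word a (cyclic_word p q (enum 'I_n.+1) i)).
  exists (cyclic_word p q (enum 'I_n.+1) i) => //.
  by rewrite /cyclic_word; case: (p) p_gt0.
by move=> a; apply: cyclic_operationE hC alpha_gt0 le_alpha hA.
Qed.
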